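(* Let $\tau$ be a finite nonempty set of proposition symbols, $t=2^{|\tau|}$, let $d:\mathbb Z_+\to\mathbb N$ be a function (counting depth) and consider $n\to\infty$. (1) If $d(n)\le n/t-f(n)$ where $f(n)=\omega(\sqrt n)$, then $\equiv_{d(n)}$ has a dominating class. (2) If $d(n)\ge n/t-f(n)$ where $f(n)=o(\sqrt n)$, then $\equiv_{d(n)}$ has no dominating class. (3) If $d(n)\ge n/t+f(n)$ where $f(n)=\omega(\sqrt n)$, then every class in $\equiv_{d(n)}$ is vanishing. (Here $f$ is a function with positive real values.)
   Context: Models: a $\tau$-model with domain $W$ assigns to each $p\in\tau$ a subset of $W$ (the points where $p$ is true). For each $n$ there are $2^{n|\tau|}$ $\tau$-models with domain $\{1,\dots,n\}$. Logic: propositional formulas are $\psi ::= p\mid\neg p\mid\psi\wedge\psi\mid\psi\vee\psi$ with $p\in\tau$. Formulas of $\mathrm{GMLU}$ are built from $\diamond^{\ge k}\psi$, $\blacksquare^{<k}\psi$, $\diamond^{=k}\psi$, $\blacksquare^{\ne k}\psi$ ($\psi$ propositional, $k\in\mathbb N$) by closing under $\wedge,\vee$ and under prefixing $\diamond^{\ge k},\blacksquare^{<k},\diamond^{=k},\blacksquare^{\ne k}$. Semantics at a point $w$: Boolean connectives as usual; $\diamond^{\ge k}\varphi$ (resp. $\diamond^{=k}\varphi$) holds iff at least (resp. exactly) $k$ points of the domain satisfy $\varphi$; $\blacksquare^{<k}\varphi$ is equivalent to $\neg\diamond^{\ge k}\neg\varphi$ and $\blacksquare^{\ne k}\varphi$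 to $\neg\diamond^{=k}\neg\varphi$. Truth of a $\mathrm{GMLU}$-formula in a model does not depend on the point, so $\mathfrak M\vDash\varphi$ is well defined. $\mathrm{GMLU}_d$ is the set of formulas of counting depth at most $d$, i.e. in which every occurring $\diamond^{\ge k},\blacksquare^{<k}$ has $k\le d$ and every occurring $\diamond^{=k},\blacksquare^{\ne k}$ has $k+1\le d$. For each $n$, $\equiv_{d(n)}$ is the equivalence relation on the $\tau$-models with domain $\{1,\dots,n\}$ relating models that satisfy the same $\mathrm{GMLU}_{d(n)}$-formulas. A class sequence is a function $M(n)$ choosing, for each $n$, one equivalence class of $\equiv_{d(n)}$; its probability sequence is $p_n=|M(n)|/2^{n|\tau|}$. $\equiv_{d(n)}$ has a dominating class if some class sequence has $p_n\to1$ as $n\to\infty$. All (every) classes in $\equiv_{d(n)}$ are vanishing if every class sequence has $p_n\to0$. Asymptotics: $f=o(g)$ means $f(n)/g(n)\to0$; $f=\omega(g)$ means $f(n)/g(n)\to\infty$. *)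

(* Defs.v *)
From mathcomp Require Import all_boot all_order all_algebra.
From mathcomp Require Import all_classical all_reals all_analysis.
Import Order.TTheory GRing.Theory Num.Theory.
Import numFieldNormedType.Exports.

Set Implicit Arguments.
Unset Strict Implicit.
Unset Printing Implicit Defensive.

Local Open Scope ring_scope.

Section Logic.

Variable tau : finType.

Definition model (W : finType) := {ffun tau -> {set W}}.

Lemma card_model n : #|model 'I_n| = (2 ^ (n * #|tau|))%N.
Proof. by rewrite card_ffun -cardsT -powersetT card_powerset cardsT card_ord expnM. Qed.

Inductive pform :=
| PSym of tau
| PNeg of tau
| PAnd of pform & pform
| POr of pform & pform.

Inductive modality :=
| DiaGe of nat
| BoxLt of nat
| DiaEq of nat
| BoxNe of nat.

Inductive gmlu :=
| GProp of modality & pform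
| GMod of modality & gmlu
| GAnd of gmlu & gmlu
| GOr of gmlu & gmlu.

Section Semantics.

Variables (W : finType) (M : model W).

Fixpoint psat (w : W) (psi : pform) : bool :=
  match psi with
  | PSym p => w \in M p
  | PNeg p => w \notin M p
  | PAnd a b => psat w a && psat w b
  | POr a b => psat w a || psat w b
  end.

(* The modalities range over the whole domain, so the truth value of a
   modalized formula depends only on the set of points satisfying its body. *)
Definition modsat (m : modality) (S : pred W) : bool :=
  match m with
  | DiaGe k => (k <= #|[pred v | S v]|)%N
  | BoxLt k => ~~ (k <= #|[pred v | ~~ S v]|)%N
  | DiaEq k => #|[pred v | S v]| == k
  | BoxNe k => ~~ (#|[pred v | ~~ S v]| == k)
  end.

Fixpoint gsat (w : W) (phi : gmlu) : bool :=
  match phi with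
  | GProp m psi => modsat m (fun v => psat v psi)
  | GMod m a => modsat m (fun v => gsat v a)
  | GAnd a b => gsat w a && gsat w b
  | GOr a b => gsat w a || gsat w b
  end.

Lemma gsat_point (v w : W) (phi : gmlu) : gsat v phi = gsat w phi.
Proof. by elim: phi => //= a -> b ->. Qed.

(* On a nonempty domain, truth at all points is truth at any single point,
   by gsat_point. *)
Definition models (phi : gmlu) : bool := [forall w, gsat w phi].

End Semantics.

Definition mod_depth (m : modality) : nat :=
  match m with
  | DiaGe k | BoxLt k => k
  | DiaEq k | BoxNe k => k.+1
  end.

Fixpoint counting_depth (phi : gmlu) : nat :=
  match phi with
  | GProp m _ => mod_depth m
  | GMod m a => maxn (mod_depth m) (counting_depth a)
  | GAnd a b | GOr a b => maxn (counting_depth a) (counting_depth b)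
  end.

Definition gmlu_equiv (d : nat) (W : finType) (M N : model W) : Prop :=
  forall phi : gmlu, (counting_depth phi <= d)%N -> models M phi = models N phi.

Definition is_class (d : nat) (W : finType) (C : {set model W}) : Prop :=
  exists M : model W, forall N : model W, N \in C <-> gmlu_equiv d M N.

(* The domain {1, ..., n} is represented by 'I_n. The index n = 0 carries no
   information: the sequences of interest are indexed by positive integers. *)
Definition class_sequence (d : nat -> nat) (C : forall n, {set model 'I_n}) :
    Prop :=
  forall n, (0 < n)%N -> is_class (d n) (C n).

Definition class_prob (R : realType) (C : forall n, {set model 'I_n}) (n : nat) :
    R :=
  #|C n|%:R / 2 ^+ (n * #|tau|).

Definition has_dominating_class (R : realType) (d : nat -> nat) : Prop :=
  exists C : forall n, {set model 'I_n},
    class_sequence d C /\ (class_prob R C n @[n --> \oo] --> (1 : R))%classic.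

Definition all_classes_vanishing (R : realType) (d : nat -> nat) : Prop :=
  forall C : forall n, {set model 'I_n},
    class_sequence d C -> (class_prob R C n @[n --> \oo] --> (0 : R))%classic.

End Logic.

Definition little_o (R : realType) (f g : nat -> R) : Prop :=
  (f n / g n @[n --> \oo] --> (0 : R))%classic.

Definition little_omega (R : realType) (f g : nat -> R) : Prop :=
  (f n / g n @[n --> \oo] --> +oo)%classic.

(* Main.v *)
Require Import Defs.
From mathcomp Require Import all_boot all_order all_algebra.
From mathcomp Require Import all_classical all_reals all_analysis.
From mathcomp Require Import ring lra zify.
Import Order.TTheory GRing.Theory Num.Theory.
Import numFieldNormedType.Exports.

Local Open Scope ring_scope.

(** Call the set of symbols true at a point its type; there are [t = 2 ^ #|tau|]
types.  A modality only counts the points whose type lies in some set of types,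
and it cannot tell counts beyond the depth [d] apart, while every single type is
defined by a conjunction of literals.  So a class of the depth-[d] equivalence
is exactly a vector of truncated type counts [minn d (type_count M T)]
([gmlu_equivP]).  In a uniformly random model with [n] points the points have
independent uniform types, so each type count is binomial with mean [n / t]
([type_count_pgf]), and the three regimes compare [d] with [n / t] on the scale
[sqrt n] of the fluctuations.

- If [d] is far below the mean, Chebyshev's inequality and a union bound over the
  [t] types show that every count reaches [d] with probability tending to [1];
  the models where this happens are all equivalent ([all_counts_ge_likely]).
- In general, a class either prescribes the exact value of some count, or forces
  all counts to be at least [d].  The first kind has small probability because
  the largest atom of the binomial distribution tends to [0]
  ([bin_pgf_coef_small]).  If [d] is at least [n / t - o(sqrt n)], the second
  kind confines a count to a window of width [o(sqrt n)] around its mean, the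
  upper bound coming from the fact that the counts add up to [n]; the second and
  fourth moments show that the probability of such a window stays away from [1]
  ([card_le_of_concentrated]).
- If [d] exceeds [n / t], the second kind is impossible since the counts add up
  to [n], so only classes of small probability are left. *)

(** * The binomial distribution *)

Section Binomial.
Context {R : realType}.
Variable p : R.
Implicit Types (n c : nat) (g : nat -> R).

(** Keeping the distribution as its probability generating function lets it be
obtained in one stroke from a product over the points, and turns the recursion
in the number of trials into multiplication by one more factor. *)
Definition bin_pgf n : {poly R} := (p *: 'X + (1 - p)%:P) ^+ n.

Definition bin_mean n g : R := \sum_(c < n.+1) (bin_pgf n)`_c * g c.

Lemma bin_pgf0 c : (bin_pgf 0)`_c = (c == 0)%N%:R.
Proof. by rewrite /bin_pgf expr0 coef1. Qed.

Lemma bin_pgfS n c : (bin_pgf n.+1)`_c =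
  (if c is c'.+1 then p * (bin_pgf n)`_c' else 0) + (1 - p) * (bin_pgf n)`_c.
Proof.
rewrite /bin_pgf exprS mulrDl coefD -scalerAl coefZ coefXM coefCM.
by case: c => [|c] //=; rewrite mulr0.
Qed.

Lemma bin_pgf_gt n c : (n < c)%N -> (bin_pgf n)`_c = 0.
Proof.
elim: n c => [|n IH] [|c] //= ltnc; first by rewrite bin_pgf0.
by rewrite bin_pgfS !IH ?mulr0 ?addr0 // ltnW.
Qed.

Lemma bin_meanS n g : bin_mean n.+1 g =
  p * bin_mean n (g \o succn) + (1 - p) * bin_mean n g.
Proof.
rewrite /bin_mean; under eq_bigr do rewrite bin_pgfS mulrDl.
rewrite big_split /= big_ord_recl /= mul0r add0r !mulr_sumr.
congr (_ + _); first by apply: eq_bigr => i _; rewrite /= mulrA.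
rewrite big_ord_recr /= bin_pgf_gt // mulr0 mul0r addr0.
by apply: eq_bigr => i _; rewrite mulrA.
Qed.

Lemma bin_meanD n g1 g2 :
  bin_mean n (fun c => g1 c + g2 c) = bin_mean n g1 + bin_mean n g2.
Proof. by rewrite -big_split; apply: eq_bigr => i _; rewrite mulrDr. Qed.

Lemma bin_meanZ n a g : bin_mean n (fun c => a * g c) = a * bin_mean n g.
Proof. by rewrite /bin_mean mulr_sumr; apply: eq_bigr => i _; rewrite mulrCA. Qed.

Lemma eq_bin_mean n g1 g2 : g1 =1 g2 -> bin_mean n g1 = bin_mean n g2.
Proof. by move=> eg; apply: eq_bigr => i _; rewrite eg. Qed.

Lemma bin_mean1 n : bin_mean n (fun=> 1) = 1.
Proof.
elim: n => [|n IH]; first by rewrite /bin_mean big_ord1 bin_pgf0 mulr1.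
by rewrite bin_meanS /comp IH; lra.
Qed.

Definition bin_moment k n := bin_mean n (fun c => (c%:R - n%:R * p) ^+ k).

(** Splitting off one trial moves the centred count by [1 - p] with probability
[p] and by [- p] with probability [1 - p]; every moment below is computed by
expanding the power after this shift. *)
Lemma bin_moment_shift k n : bin_moment k n.+1 =
  p * bin_mean n (fun c => (c%:R - n%:R * p + (1 - p)) ^+ k)
  + (1 - p) * bin_mean n (fun c => (c%:R - n%:R * p - p) ^+ k).
Proof.
rewrite /bin_moment bin_meanS; congr (_ * _ + _ * _); apply: eq_bin_mean => c /=;
  congr (_ ^+ _); rewrite -?natr1; ring.
Qed.

Lemma bin_moment_start k : bin_moment k.+1 0 = 0.
Proof. by rewrite /bin_moment /bin_mean big_ord1 mul0r subr0 expr0n mulr0. Qed.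

Lemma bin_moment1 n : bin_moment 1 n = 0.
Proof.
elim: n => [|n IH]; first exact: bin_moment_start.
rewrite bin_moment_shift.
have E a : bin_mean n (fun c => (c%:R - n%:R * p + a) ^+ 1) = a.
  rewrite (@eq_bin_mean _ _ (fun c => (c%:R - n%:R * p) ^+ 1 + a * 1)).
    by rewrite bin_meanD bin_meanZ bin_mean1 -/(bin_moment 1 n) IH; ring.
  by move=> c /=; ring.
by rewrite !E; ring.
Qed.

Lemma bin_moment2 n : bin_moment 2 n = n%:R * (p * (1 - p)).
Proof.
elim: n => [|n IH]; first by rewrite bin_moment_start mul0r.
rewrite bin_moment_shift.
have E a : bin_mean n (fun c => (c%:R - n%:R * p + a) ^+ 2) =
    n%:R * (p * (1 - p)) + a ^+ 2.
  rewrite (@eq_bin_mean _ _ (fun c => (c%:R - n%:R * p) ^+ 2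
     + ((2 * a) * (c%:R - n%:R * p) ^+ 1 + a ^+ 2 * 1))).
    rewrite !bin_meanD !bin_meanZ bin_mean1 -/(bin_moment 1 n) -/(bin_moment 2 n).
    by rewrite IH bin_moment1; ring.
  by move=> c /=; ring.
by rewrite !E -natr1; ring.
Qed.

(** The third moment, which need not vanish, disappears from this recursion
because its coefficient is four times the mean shift [0] of the last trial. *)
Lemma bin_moment4S n : bin_moment 4 n.+1 = bin_moment 4 n
  + p * (1 - p) * (6 * n%:R * (p * (1 - p)) + (p ^+ 3 + (1 - p) ^+ 3)).
Proof.
rewrite bin_moment_shift.
have E a : bin_mean n (fun c => (c%:R - n%:R * p + a) ^+ 4) =
    bin_moment 4 n + 4 * a * bin_moment 3 n
    + 6 * a ^+ 2 * (n%:R * (p * (1 - p))) + a ^+ 4.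
  rewrite (@eq_bin_mean _ _ (fun c => (c%:R - n%:R * p) ^+ 4
     + ((4 * a) * (c%:R - n%:R * p) ^+ 3 + (6 * a ^+ 2 * (c%:R - n%:R * p) ^+ 2
     + (4 * a ^+ 3 * (c%:R - n%:R * p) ^+ 1 + a ^+ 4 * 1))))).
    rewrite !bin_meanD !bin_meanZ bin_mean1 -/(bin_moment 1 n).
    rewrite -/(bin_moment 2 n) -/(bin_moment 3 n) -/(bin_moment 4 n).
    by rewrite bin_moment1 bin_moment2; ring.
  by move=> c /=; ring.
by rewrite !E; ring.
Qed.

Hypothesis p01 : 0 < p < 1.

(** The fourth moment has the order of the square of the variance, which is what
keeps the distribution from concentrating below the scale of its deviation. *)
Lemma bin_moment4_le n : bin_moment 4 n <= n%:R ^+ 2.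
Proof.
have [p0 p1] := andP p01.
elim: n => [|n IH]; first by rewrite bin_moment_start expr0n.
rewrite bin_moment4S -[n.+1%:R]natr1.
have s0 : 0 < p * (1 - p) by rewrite mulr_gt0 // subr_gt0.
have s4 : p * (1 - p) <= 4^-1.
  by have := sqr_ge0 (p - 2^-1); rewrite sqrrB; lra.
have -> : p ^+ 3 + (1 - p) ^+ 3 = 1 - 3 * (p * (1 - p)) by ring.
set s := p * (1 - p) in s0 s4 *.
have n0 : 0 <= n%:R :> R by [].
have : s * s * n%:R <= 16^-1 * n%:R by apply: ler_wpM2r => //; nra.
have -> : s * (6 * n%:R * s + (1 - 3 * s)) = 6 * (s * s * n%:R) + s - 3 * (s * s).
  by ring.
nra.
Qed.

(** The squared l2 norm of the distribution. *)
Definition bin_energy n : R := \sum_(c < n.+1) (bin_pgf n)`_c ^+ 2.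

(** The squared l2 norm of the discrete derivative, without the jump at [0]. *)
Definition bin_dirichlet n : R := \sum_(c < n.+1) ((bin_pgf n)`_c - (bin_pgf n)`_c.+1) ^+ 2.

(** One more trial replaces the distribution by a convex combination of itself
and its translate, and strict convexity of the square makes the energy drop by
[p * (1 - p)] times the Dirichlet form, whose term at the left end of the
support is the last summand. *)
Lemma bin_energyS n :
  bin_energy n - bin_energy n.+1 = p * (1 - p) * (bin_dirichlet n + (bin_pgf n)`_0 ^+ 2).
Proof.
rewrite /bin_energy /bin_dirichlet; set a := fun c => (bin_pgf n)`_c.
have aend : a n.+1 = 0 by rewrite /a bin_pgf_gt.
have S1 : \sum_(c < n.+1) a c.+1 ^+ 2 = \sum_(c < n.+1) a c ^+ 2 - a 0%N ^+ 2.
  rewrite big_ord_recr /= aend expr0n addr0 [in RHS]big_ord_recl /=.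
  by rewrite addrAC subrr add0r.
rewrite [X in _ - X]big_ord_recl /= bin_pgfS add0r.
have -> : \sum_(i < n.+1) (bin_pgf n.+1)`_(bump 0 i) ^+ 2 =
   p * (\sum_(c < n.+1) a c ^+ 2) + (1 - p) * (\sum_(c < n.+1) a c.+1 ^+ 2)
   - p * (1 - p) * (\sum_(c < n.+1) (a c - a c.+1) ^+ 2).
  (* (p x + q y)^2 = p x^2 + q y^2 - p q (x - y)^2 when p + q = 1 *)
  rewrite !mulr_sumr -big_split -sumrB; apply: eq_bigr => i _ /=.
  by rewrite /bump add1n bin_pgfS -/(a i) -/(a i.+1); ring.
by rewrite S1 /a; ring.
Qed.

Let s_gt0 : 0 < p * (1 - p).
Proof. by have [p0 p1] := andP p01; rewrite mulr_gt0 // subr_gt0. Qed.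

Let bin_dirichlet_ge0 n : 0 <= bin_dirichlet n.
Proof. by apply: sumr_ge0 => i _; exact: sqr_ge0. Qed.

Let energy_anti : {homo bin_energy : m n / (m <= n)%N >-> n <= m}.
Proof.
apply/nonincreasing_seqP => n; rewrite -subr_ge0 bin_energyS.
by rewrite mulr_ge0 ?addr_ge0 ?sqr_ge0 // ltW.
Qed.

Let energy_le1 n : bin_energy n <= 1.
Proof.
apply: le_trans (energy_anti _ _ (leq0n n)) _.
by rewrite /bin_energy big_ord1 bin_pgf0 expr1n.
Qed.

(** The energy is nonnegative and nonincreasing, hence its decrements, which
dominate the Dirichlet form, tend to [0]. *)
Lemma bin_dirichlet_cvg0 : (bin_dirichlet n @[n --> \oo] --> (0 : R))%classic.
Proof.
have cv : (cvgn bin_energy)%classic.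
  apply: nonincreasing_is_cvgn => //; exists 0 => _ [n _ <-].
  by apply: sumr_ge0 => i _; exact: sqr_ge0.
have d0 : ((bin_energy n - bin_energy n.+1) / (p * (1 - p)) @[n --> \oo] --> (0 : R))%classic.
  rewrite -(mul0r ((p * (1 - p))^-1)) -(subrr (limn bin_energy)).
  apply: cvgM; last exact: cvg_cst.
  by apply: cvgB => //; rewrite (cvg_shiftS bin_energy).
apply: (squeeze_cvgr _ (cvg_cst 0) d0); near=> n.
rewrite bin_dirichlet_ge0 bin_energyS mulrC mulKf ?gt_eqF //.
by rewrite lerDl sqr_ge0.
Unshelve. all: by end_near. Qed.

(** A distribution with small derivative has no large atom: the square of an
atom telescopes into differences of squares [(x - y) * (x + y)], which weighted
arithmetic-geometric means bound by the Dirichlet form and the energy; the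
latter is at most [1]. *)
Lemma bin_pgf_sqr_le K n c : 0 < K ->
  (bin_pgf n)`_c ^+ 2 <= K * bin_dirichlet n + K^-1.
Proof.
move=> K0; have [lecn|ltnc] := leqP c n; last first.
  by rewrite bin_pgf_gt // expr0n addr_ge0 ?mulr_ge0 ?invr_ge0 // ltW.
pose a j := (bin_pgf n)`_j.
have pt j : a j ^+ 2 - a j.+1 ^+ 2 <=
    K * (a j - a j.+1) ^+ 2 + K^-1 * (2^-1 * a j ^+ 2 + 2^-1 * a j.+1 ^+ 2).
  (* [x0] is the weighted mean inequality for the two factors *)
  have x0 := sqr_ge0 (K * (a j - a j.+1) - 2^-1 * (a j + a j.+1)).
  have y0 := sqr_ge0 (a j - a j.+1).
  rewrite -(ler_pM2l K0) [X in _ <= X]mulrDr mulVKf ?gt_eqF //; nra.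
have pos j : 0 <= K * (a j - a j.+1) ^+ 2
      + K^-1 * (2^-1 * a j ^+ 2 + 2^-1 * a j.+1 ^+ 2).
  have K1 := ltW K0; have Ki : 0 <= K^-1 by rewrite invr_ge0.
  have [x0 y0] : 0 <= a j ^+ 2 /\ 0 <= a j.+1 ^+ 2 by rewrite !sqr_ge0.
  by apply: addr_ge0; [rewrite mulr_ge0 ?sqr_ge0|apply: mulr_ge0 => //; lra].
have tele : a c ^+ 2 = \sum_(c <= j < n.+1) (a j ^+ 2 - a j.+1 ^+ 2).
  rewrite (@telescope_sumr_eq _ _ _ (fun j => - a j ^+ 2)) ?(leqW lecn) //.
    by rewrite /a [in RHS]bin_pgf_gt // expr0n oppr0 add0r opprK.
  by move=> j _; rewrite opprK addrC.
rewrite -/(a c) tele.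
apply: le_trans (ler_sum _ (fun j _ => pt j)) _.
have : \sum_(c <= j < n.+1) (K * (a j - a j.+1) ^+ 2
      + K^-1 * (2^-1 * a j ^+ 2 + 2^-1 * a j.+1 ^+ 2)) <=
   \sum_(0 <= j < n.+1) (K * (a j - a j.+1) ^+ 2
      + K^-1 * (2^-1 * a j ^+ 2 + 2^-1 * a j.+1 ^+ 2)).
  rewrite [X in _ <= X](@big_cat_nat _ _ _ c) ?leqW //= lerDr.
  by apply: sumr_ge0 => j _.
move=> /le_trans; apply; rewrite big_mkord big_split /= -!mulr_sumr.
apply: lerD; first by [].
rewrite ler_piMr ?invr_ge0 ?(ltW K0) // big_split /= -!mulr_sumr.
have e1 : \sum_(j < n.+1) a j ^+ 2 <= 1 by exact: energy_le1.
suff : \sum_(j < n.+1) a j.+1 ^+ 2 <= \sum_(j < n.+1) a j ^+ 2 by lra.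
rewrite big_ord_recr /= [X in _ + X ^+ 2]bin_pgf_gt // expr0n addr0.
by rewrite [X in _ <= X]big_ord_recl lerDr sqr_ge0.
Qed.

(** Uniformity in [c] matters: the value of the count that a class prescribes
may be any function of [n]. *)
Lemma bin_pgf_coef_small (e : R) : 0 < e ->
  (\forall n \near \oo, forall c, (bin_pgf n)`_c <= e)%classic.
Proof.
(* [K^-1] takes one half of [e ^+ 2], and leaves the other half to the term with
   the Dirichlet form, which tends to [0] *)
move=> e0; pose K : R := 2 / e ^+ 2.
have e20 : 0 < e ^+ 2 by rewrite exprn_gt0.
have K0 : 0 < K by rewrite divr_gt0.
have d0 : 0 < e ^+ 2 / 2 / K by rewrite !divr_gt0.
near=> n => c; have := bin_pgf_sqr_le K n c K0.
have : bin_dirichlet n < e ^+ 2 / 2 / K.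
  by near: n; exact: (cvgr_lt _ bin_dirichlet_cvg0).
rewrite ltr_pdivlMr // mulrC => dn.
have -> : K^-1 = e ^+ 2 / 2 by rewrite /K invf_div.
move=> h; have {}h : (bin_pgf n)`_c ^+ 2 <= e ^+ 2 by lra.
have [neg|pos] := ltP (bin_pgf n)`_c 0; first by rewrite (le_trans (ltW neg)) ?ltW.
by move: h; rewrite ler_sqr // nnegrE ltW.
Unshelve. all: by end_near. Qed.

End Binomial.

(** * Equivalence of models and type counts *)

Section TypeCounts.
Context {tau W : finType}.
Implicit Types (M N : model tau W) (T : {set tau}) (d : nat).

Definition point_type M (w : W) : {set tau} := [set p | w \in M p].

Definition type_count M T : nat := #|[set w | point_type M w == T]|.

Lemma sum_type_count M : (\sum_T type_count M T)%N = #|W|.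
Proof.
rewrite -sum1_card (partition_big (point_type M) predT) //=.
by apply: eq_bigr => T _; rewrite sum1dep_card.
Qed.

Fixpoint type_sat (T : {set tau}) (psi : pform tau) : bool :=
  match psi with
  | PSym p => p \in T
  | PNeg p => p \notin T
  | PAnd a b => type_sat T a && type_sat T b
  | POr a b => type_sat T a || type_sat T b
  end.

Lemma psat_type M w psi : psat M w psi = type_sat (point_type M w) psi.
Proof. by elim: psi => /= [p|p|a -> b ->|a -> b ->] //; rewrite inE. Qed.

(** Truncation at [d] is compatible with addition, so the truncated counts of
the single types determine those of every union of types. *)
Lemma minn_card_types d M N (P : pred {set tau}) :
  (forall T, minn d (type_count M T) = minn d (type_count N T)) ->
  minn d #|[pred w | P (point_type M w)]| = minn d #|[pred w | P (point_type N w)]|.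
Proof.
move=> eqMN.
have card_sum K : #|[pred w | P (point_type K w)]| = (\sum_(T | P T) type_count K T)%N.
  rewrite -sum1_card (partition_big (point_type K) P) //=.
  apply: eq_bigr => T PT; rewrite /type_count -sum1dep_card; apply: eq_bigl => w.
  by rewrite inE andbC; case: eqP => // ->; rewrite PT.
rewrite !card_sum.
elim/big_rec2: _ => // T x y _ IH.
by move: (eqMN T); lia.
Qed.

(** A modality of depth at most [d] compares a count with a threshold that the
truncation at [d] preserves; testing equality with [k] needs [k < d], which is
why those modalities have depth [k.+1]. *)
Lemma modsat_minn d m (S S' : pred W) : (mod_depth m <= d)%N ->
  minn d #|[pred w | S w]| = minn d #|[pred w | S' w]| ->
  minn d #|[pred w | ~~ S w]| = minn d #|[pred w | ~~ S' w]| ->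
  modsat m S = modsat m S'.
Proof. by case: m => k /=; move: #|_| #|_| #|_| #|_|; lia. Qed.

Lemma eq_modsat m (S S' : pred W) : S =1 S' -> modsat m S = modsat m S'.
Proof.
move=> eqS; have eq1 : #|[pred w | S w]| = #|[pred w | S' w]|.
  by apply: eq_card => w; rewrite !inE eqS.
have eq2 : #|[pred w | ~~ S w]| = #|[pred w | ~~ S' w]|.
  by apply: eq_card => w; rewrite !inE eqS.
by case: m => k /=; rewrite ?eq1 ?eq2.
Qed.

(** Only the innermost modalities see the points: a modality above a modalized
formula looks at a set of points that is empty or full, and in both models it is
the same set. *)
Lemma gsat_type_count d M N :
  (forall T, minn d (type_count M T) = minn d (type_count N T)) ->
  forall phi, (counting_depth phi <= d)%N -> forall w, gsat M w phi = gsat N w phi.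
Proof.
move=> eqMN; elim=> [m psi|m a IHa|a IHa b IHb|a IHa b IHb] /=; rewrite ?geq_max.
- move=> md _; rewrite (eq_modsat _ _ _ (psat_type M ^~ psi)).
  rewrite (eq_modsat _ _ _ (psat_type N ^~ psi)).
  apply: (modsat_minn d) => //.
    exact: (minn_card_types d M N (type_sat ^~ psi)).
  exact: (minn_card_types d M N (fun T => ~~ type_sat T psi)).
- by case/andP=> _ /IHa eqa w; apply: eq_modsat.
- by case/andP=> /IHa eqa /IHb eqb w; rewrite eqa eqb.
- by case/andP=> /IHa eqa /IHb eqb w; rewrite eqa eqb.
Qed.

Definition type_literal T (p : tau) : pform tau :=
  if p \in T then PSym p else PNeg p.

(** The grammar has no constant for truth, so the empty conjunction is replaced
by a literal that occurs in the conjunction anyway. *)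
Definition type_form (p0 : tau) T : pform tau :=
  foldr (fun p psi => PAnd (type_literal T p) psi) (type_literal T p0) (enum tau).

Lemma psat_type_form p0 M w T : psat M w (type_form p0 T) = (point_type M w == T).
Proof.
have litE p : psat M w (type_literal T p) = ((p \in point_type M w) == (p \in T)).
  by rewrite /type_literal inE; case: (p \in T) => /=; case: (w \in M p).
have allE s : psat M w (foldr (fun p psi => PAnd (type_literal T p) psi)
     (type_literal T p0) s) = all (fun p => (p \in point_type M w) == (p \in T)) (p0 :: s).
  by elim: s => [|p s IH] /=; rewrite ?IH litE ?andbT //= andbCA.
rewrite allE; apply/allP/eqP => [eqT|-> //].
by apply/setP => p; apply/eqP/eqT; rewrite inE mem_enum orbT.
Qed.

(** From left to right, the formulas saying that the type [T] has at least [k]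
points, for [k] up to [d], recover the truncated count of [T]. *)
Lemma gmlu_equivP d M N : (0 < #|tau|)%N -> (0 < #|W|)%N ->
  gmlu_equiv d M N <->
  forall T, minn d (type_count M T) = minn d (type_count N T).
Proof.
case/card_gt0P=> p0 _ /card_gt0P[w0 _].
split=> [eqMN T|eqMN phi dphi]; last first.
  by apply: eq_forallb => w; exact: (gsat_type_count _ _ _ eqMN).
have geE k K : models K (GProp (DiaGe k) (type_form p0 T)) = (k <= type_count K T)%N.
  have -> : type_count K T = #|[pred v | psat K v (type_form p0 T)]|.
    by apply: eq_card => v; rewrite !inE psat_type_form.
  by apply/forallP/idP => [/(_ w0)|].
have {}geE k : (k <= d)%N -> (k <= type_count M T)%N = (k <= type_count N T)%N.
  by rewrite -!geE => kd; apply: eqMN.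
by move: (geE _ (geq_minl d (type_count M T))) (geE _ (geq_minl d (type_count N T))); lia.
Qed.

End TypeCounts.

(** * Type counts of a random model *)

Lemma card_types (tau : finType) : #|{: {set tau}}| = (2 ^ #|tau|)%N.
Proof. by rewrite -[LHS]cardsT -powersetT card_powerset cardsT. Qed.

Definition type_prob (R : realType) (tau : finType) : R := (2 ^+ #|tau|)^-1.

Section Law.
Context {R : realType} {tau : finType}.
Implicit Types (n c : nat) (T : {set tau}).
Local Notation p := (type_prob R tau).

Let model_of_types n (h : {ffun 'I_n -> {set tau}}) : model tau 'I_n :=
  [ffun q => [set w | q \in h w]].

(** Choosing a model is choosing a type for each point independently, so the
generating function of a count is a product over the points of the generating
function of a single Bernoulli trial with success probability [1 / t]. *)
Lemma type_count_pgf n T :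
  \sum_(M : model tau 'I_n) (2 ^+ (n * #|tau|))^-1 *: 'X^(type_count M T) =
  bin_pgf p n :> {poly R}.
Proof.
have ptE (h : {ffun 'I_n -> {set tau}}) w : point_type (model_of_types n h) w = h w.
  by apply/setP => q; rewrite inE ffunE inE.
have mK : cancel (@model_of_types n) (fun M => [ffun w => point_type M w]).
  by move=> h; apply/ffunP => w; rewrite ffunE ptE.
have Km : cancel (fun M => [ffun w => point_type M w]) (@model_of_types n).
  by move=> M; apply/ffunP => q; rewrite ffunE; apply/setP => w; rewrite inE ffunE inE.
rewrite (reindex _ (onW_bij _ (Bijective mK Km))) /=.
pose x (U : {set tau}) : {poly R} := p *: (if U == T then 'X else 1).
have termE (h : {ffun 'I_n -> {set tau}}) : (2 ^+ (n * #|tau|))^-1 *: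
    'X^(type_count (model_of_types n h) T) = \prod_(w < n) x (h w).
  rewrite /x scaler_prod prodr_const card_ord /type_prob exprVn -exprM mulnC.
  congr (_ *: _); rewrite -big_mkcond /= prodr_const; congr (_ ^+ _).
  by apply: eq_card => w; rewrite !inE ptE.
rewrite (eq_bigr _ (fun h _ => termE h)) -(bigA_distr_bigA (fun=> x)) /=.
rewrite prodr_const card_ord /bin_pgf; congr (_ ^+ _).
rewrite (bigD1 T) //= /x eqxx; congr (_ + _).
rewrite (eq_bigr (fun=> p%:P)); last first.
  by move=> U /negPf ->; rewrite alg_polyC.
rewrite sumr_const -polyCMn; congr (_%:P).
have -> : #|[pred U | U != T]| = (2 ^ #|tau|).-1.
  by rewrite cardC1 card_types.
rewrite -mulr_natr -subn1 natrB ?expn_gt0 // natrX /type_prob mulrBr mulr1.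
by rewrite mulVf // expf_neq0 // pnatr_eq0.
Qed.

Lemma type_count_mean n T (g : nat -> R) :
  (\sum_(M : model tau 'I_n) g (type_count M T)) / 2 ^+ (n * #|tau|) = bin_mean p n g.
Proof.
rewrite /bin_mean -(type_count_pgf n T).
under [RHS]eq_bigr do rewrite coef_sum mulr_suml.
rewrite exchange_big mulr_suml /=; apply: eq_bigr => M _.
have cM : (type_count M T < n.+1)%N by rewrite ltnS -[n in (_ <= n)%N]card_ord max_card.
rewrite (bigD1 (Ordinal cM)) //= big1 => [|c neq]; rewrite coefZ coefXn.
  by rewrite eqxx mulr1 addr0 mulrC.
case: eqP => [eqc|_]; last by rewrite mulr0 mul0r.
by case/eqP: neq; apply: val_inj.
Qed.

(** All probability bounds below have this form: the indicator of an event is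
majorized by a function of one type count, whose mean is computed in the
binomial distribution. *)
Lemma card_le_mean n T (g : nat -> R) (A : {set model tau 'I_n}) :
  (forall M, (M \in A)%:R <= g (type_count M T)) ->
  #|A|%:R / 2 ^+ (n * #|tau|) <= bin_mean p n g.
Proof.
move=> leg; rewrite -(type_count_mean n T) ler_pM2r ?invr_gt0 ?exprn_gt0 //.
by rewrite -sum1_card natr_sum big_mkcond /=; apply: ler_sum => M _; case: ifP (leg M).
Qed.

Lemma card_le_pgf n T c (A : {set model tau 'I_n}) :
  (forall M, M \in A -> type_count M T = c) ->
  #|A|%:R / 2 ^+ (n * #|tau|) <= (bin_pgf p n)`_c.
Proof.
move=> cA; apply: (@le_trans _ _ (bin_mean p n (fun k => (k == c)%:R))).
  apply: (card_le_mean n T) => M.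
  by case: (boolP (M \in A)) => [/cA ->|_]; rewrite ?eqxx.
rewrite /bin_mean; have [lec|gtc] := ltnP c n.+1.
  rewrite (bigD1 (Ordinal lec)) //= big1 => [|k neq]; first by rewrite eqxx mulr1 addr0.
  case: eqP => [eqc|_]; last by rewrite mulr0.
  by case/eqP: neq; apply: val_inj.
rewrite big1 ?bin_pgf_gt // => k _.
by rewrite ltn_eqF ?mulr0 // (leq_trans _ gtc).
Qed.

Hypothesis tau_gt0 : (0 < #|tau|)%N.

Lemma type_prob_bounds : 0 < p < 1.
Proof.
rewrite invr_gt0 exprn_gt0 //= invf_lt1 ?exprn_gt0 // exprn_egt1 ?ltr1n //.
by rewrite -lt0n.
Qed.

Let s := p * (1 - p).

Lemma type_var_bounds : 0 < s <= 1.
Proof.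
rewrite /s; have /andP[p0 p1] := type_prob_bounds.
by rewrite mulr_gt0 ?subr_gt0 //=; nra.
Qed.

(** Anticoncentration from two moments, in the manner of Paley and Zygmund.  With
[u] the squared deviation normalized so that its mean is [s ^+ 2], the event
says [u <= s ^+ 2 / 4], and the mean of [u ^+ 2] is at most [s ^+ 2].  The
majorant [(1 - u / 2) ^+ 2 + s ^+ 2 / 4] of the indicator then has mean at most
[1 - s ^+ 2 / 2]. *)
Lemma card_le_of_concentrated n T (A : {set model tau 'I_n}) : (0 < n)%N ->
  (forall M, M \in A -> ((type_count M T)%:R - n%:R * p) ^+ 2 <= s * n%:R / 4) ->
  #|A|%:R / 2 ^+ (n * #|tau|) <= 1 - s ^+ 2 / 2.
Proof.
move=> n0 cA; have nR0 : 0 < n%:R :> R by rewrite ltr0n.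
have /andP[s0 s1] := type_var_bounds.
pose y c : R := c%:R - n%:R * p.
pose g c := (1 + s ^+ 2 / 4) * 1 + (- (s / n%:R) * y c ^+ 2
  + (s ^+ 2 / (4 * n%:R ^+ 2)) * y c ^+ 4).
have gE c : g c = (1 - s / n%:R * y c ^+ 2 / 2) ^+ 2 + s ^+ 2 / 4.
  by rewrite /g; field; rewrite gt_eqF.
apply: (@le_trans _ _ (bin_mean p n g)).
  apply: (card_le_mean n T) => M; rewrite gE.
  have : M \in A -> s / n%:R * y (type_count M T) ^+ 2 <= s ^+ 2 / 4.
    move=> /cA le1; have := ler_wpM2l (ltW (divr_gt0 s0 nR0)) le1.
    by congr (_ <= _); field; rewrite gt_eqF.
  case: (M \in A) => /=; last by move=> _; rewrite addr_ge0 ?sqr_ge0 // divr_ge0 ?sqr_ge0.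
  by move=> /(_ isT); set u := _ * _ ^+ 2; have := sqr_ge0 u; nra.
rewrite /g !bin_meanD !bin_meanZ bin_mean1 -/(bin_moment p 2 n) -/(bin_moment p 4 n).
rewrite bin_moment2 -/s.
have m4 : s ^+ 2 / (4 * n%:R ^+ 2) * bin_moment p 4 n <= s ^+ 2 / 4.
  apply: le_trans (ler_wpM2l _ (bin_moment4_le _ type_prob_bounds n)) _.
    by rewrite divr_ge0 ?sqr_ge0 // mulr_ge0 ?sqr_ge0.
  have -> : s ^+ 2 / (4 * n%:R ^+ 2) * n%:R ^+ 2 = s ^+ 2 / 4 :> R.
    by field; rewrite gt_eqF.
  by [].
have -> : - (s / n%:R) * (n%:R * s) = - s ^+ 2 by field; rewrite gt_eqF.
by lra.
Qed.

(** A model outside [A] has a count that lies below its mean by [f] or more;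
Chebyshev's inequality is summed over all types. *)
Lemma all_counts_ge_likely n d (f : R) (A : {set model tau 'I_n}) :
  0 < f -> d%:R <= n%:R * p - f ->
  (forall M, (forall T, (d <= type_count M T)%N) -> M \in A) ->
  1 - #|A|%:R / 2 ^+ (n * #|tau|) <= 2 ^+ #|tau| * n%:R / f ^+ 2.
Proof.
move=> f0 dle inA; have f20 : 0 < f ^+ 2 by rewrite exprn_gt0.
pose y c : R := c%:R - n%:R * p.
have N0 : 0 < 2 ^+ (n * #|tau|) :> R by rewrite exprn_gt0.
have pt (M : model tau 'I_n) : 1 <= (M \in A)%:R
    + \sum_T (f ^+ 2)^-1 * y (type_count M T) ^+ 2.
  have pos T : 0 <= (f ^+ 2)^-1 * y (type_count M T) ^+ 2.
    by rewrite mulr_ge0 ?invr_ge0 ?sqr_ge0.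
  have [allT|] := boolP [forall T, (d <= type_count M T)%N].
    by rewrite inA ?lerDl ?sumr_ge0 //; exact/forallP.
  rewrite negb_forall => /existsP[T]; rewrite -ltnNge => cT.
  rewrite (bigD1 T) //=; apply: (@le_trans _ _ ((f ^+ 2)^-1 * y (type_count M T) ^+ 2)).
    rewrite mulrC ler_pdivlMr // mul1r -[leRHS]sqrrN ler_sqr ?nnegrE ?(ltW f0) //.
    - by move: cT; rewrite -(ltr_nat R) /y; lra.
    - by move: cT; rewrite -(ltr_nat R) /y; lra.
  by rewrite addrCA lerDl addr_ge0 ?sumr_ge0.
have cardA : \sum_(M : model tau 'I_n) (M \in A)%:R = #|A|%:R :> R.
  by rewrite -sum1_card natr_sum [RHS]big_mkcond /=; apply: eq_bigr => M _; case: ifP.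
have card1 : \sum_(M : model tau 'I_n) 1 = 2 ^+ (n * #|tau|) :> R.
  by rewrite sumr_const card_model natrX.
have meanE T : (\sum_(M : model tau 'I_n) (f ^+ 2)^-1 * y (type_count M T) ^+ 2)
    / 2 ^+ (n * #|tau|) = n%:R * s / f ^+ 2.
  rewrite (type_count_mean n T (fun c => (f ^+ 2)^-1 * y c ^+ 2)) bin_meanZ.
  by rewrite -/(bin_moment p 2 n) bin_moment2 mulrC.
have := @ler_sum R _ (index_enum _) predT (fun=> 1) _ (fun M _ => pt M).
rewrite card1 big_split /= cardA exchange_big /= -(ler_pM2r (x := (2 ^+ (n * #|tau|))^-1)) ?invr_gt0 //.
rewrite divff ?gt_eqF // mulrDl mulr_suml (eq_bigr _ (fun T _ => meanE T)) sumr_const.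
rewrite card_types -(mulr_natl (n%:R * s / f ^+ 2)) natrX => le1.
rewrite lerBlDl; apply: le_trans le1 _; rewrite lerD2l -[leRHS]mulrA ler_pM2l ?exprn_gt0 //.
rewrite ler_pM2r ?invr_gt0 // ler_piMr //.
by case/andP: type_var_bounds.
Qed.

(** A count below [d] is not affected by the truncation, so all models of the
class share it. *)
Lemma class_le_pgf n d (M : model tau 'I_n) (C : {set model tau 'I_n}) T :
  (0 < n)%N -> (forall N, N \in C <-> gmlu_equiv d M N) -> (type_count M T < d)%N ->
  #|C|%:R / 2 ^+ (n * #|tau|) <= (bin_pgf p n)`_(type_count M T).
Proof.
move=> n0 CE ltd; apply: (card_le_pgf n T) => N /CE.
rewrite gmlu_equivP ?card_ord // => /(_ T); lia.
Qed.

End Law.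

(** * The three regimes *)

Theorem theorem5p8 (R : realType) (tau : finType) (htau : (0 < #|tau|)%N)
    (d : nat -> nat) :
  let t : R := 2 ^+ #|tau| in
  let sqrtn := fun n : nat => Num.sqrt (n%:R : R) in
  (forall f : nat -> R,
     (forall n, (0 < n)%N -> 0 < f n) ->
     little_omega f sqrtn ->
     (forall n, (0 < n)%N -> (d n)%:R <= n%:R / t - f n) ->
     has_dominating_class tau R d) /\
  (forall f : nat -> R,
     (forall n, (0 < n)%N -> 0 < f n) ->
     little_o f sqrtn ->
     (forall n, (0 < n)%N -> n%:R / t - f n <= (d n)%:R) ->
     ~ has_dominating_class tau R d) /\
  (forall f : nat -> R,
     (forall n, (0 < n)%N -> 0 < f n) ->
     little_omega f sqrtn ->
     (forall n, (0 < n)%N -> n%:R / t + f n <= (d n)%:R) ->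
     all_classes_vanishing tau R d).
Proof.
move=> t sqrtn.
have t0 : 0 < t by rewrite exprn_gt0.
have tE : (2 ^ #|tau|)%:R = t by rewrite natrX.
have sum_count n (M : model tau 'I_n) :
    \sum_T (type_count M T)%:R = n%:R :> R.
  by rewrite -natr_sum sum_type_count card_ord.
have pE n : n%:R / t = n%:R * type_prob R tau :> R by [].
split; last split.
- move=> f f0 fo dle.
  (* If the counts of some model all reach [d n], then so do those of [M n], and
     the class of [M n] contains all such models. *)
  pose M n : model tau 'I_n := odflt [ffun=> finset.set0]
    [pick M : model tau 'I_n | [forall T, (d n <= type_count M T)%N]].
  pose C n := [set N : model tau 'I_n | [forall T,
    minn (d n) (type_count (M n) T) == minn (d n) (type_count N T)]].
  exists C; split=> [n n0|].
    exists (M n) => N; rewrite gmlu_equivP ?card_ord // inE.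
    by split=> [/forallP h T|h]; [exact/eqP|apply/forallP => T; exact/eqP].
  have inC n (N : model tau 'I_n) : (forall T, (d n <= type_count N T)%N) -> N \in C n.
    move=> geN; rewrite inE /M; case: pickP => [K /forallP geK|/(_ N)] /=.
      by apply/forallP => T; rewrite !(minn_idPl _).
    by move/negP; case; apply/forallP.
  apply/cvgrPdist_le => e e0; near=> n.
  have n0 : (0 < n)%N by near: n; exact: nbhs_infty_gt.
  have N0 : 0 < 2 ^+ (n * #|tau|) :> R by rewrite exprn_gt0.
  have le1 : class_prob R C n <= 1.
    by rewrite /class_prob ler_pdivrMr // mul1r -natrX ler_nat -card_model max_card.
  rewrite ger0_norm ?subr_ge0 //.
  apply: le_trans (all_counts_ge_likely htau n (d n) _ _ (f0 n n0) (dle n n0) (inC n)) _.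
  have r0 : 0 < sqrtn n by rewrite sqrtr_gt0 ltr0n.
  have -> : n%:R = sqrtn n ^+ 2 by rewrite sqr_sqrtr.
  (* any bound [x] with [e * x ^+ 2 >= t] would do *)
  have : t / e + 1 <= f n / sqrtn n by near: n; move/cvgryPge: fo; exact.
  rewrite ler_pdivlMr // => le_f.
  rewrite ler_pdivrMr ?exprn_gt0 ?f0 // -/t.
  have te : 0 < t / e by rewrite divr_gt0.
  apply: (@le_trans _ _ (e * ((t / e + 1) * sqrtn n) ^+ 2)); last first.
    have fge0 := ltW (f0 n n0); have te1 : 0 < t / e + 1 by rewrite addr_gt0.
    by rewrite ler_pM2l // ler_sqr // nnegrE mulr_ge0 // ltW.
  have -> : e * ((t / e + 1) * sqrtn n) ^+ 2 = (t * (t / e + 1) + (t + e)) * sqrtn n ^+ 2.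
    by field; rewrite gt_eqF.
  rewrite ler_pM2r ?exprn_gt0 //; nra.
- move=> f f0 fo dge [C [Ccl C1]].
  have /andP[s0 s1] := type_var_bounds (R := R) htau.
  set s := type_prob R tau * (1 - type_prob R tau) in s0 s1.
  (* [b] bounds the probability of both kinds of classes for large [n] *)
  pose b : R := 1 - s ^+ 2 / 2.
  have b0 : 0 < b by rewrite /b; nra.
  have b1 : b < 1 by rewrite /b; nra.
  have d0 : 0 < s / (2 * t) by rewrite divr_gt0 // mulr_gt0.
  near (\oo)%classic => n.
  have n0 : (0 < n)%N by near: n; exact: nbhs_infty_gt.
  have big : b < class_prob R C n by near: n; exact: (cvgr_gt _ C1).
  have small c : (bin_pgf (type_prob R tau) n)`_c <= b.
    by move: c; near: n; apply: bin_pgf_coef_small => //; exact: type_prob_bounds.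
  have fn : f n / sqrtn n < s / (2 * t) by near: n; exact: (cvgr_lt _ fo).
  have [M CE] := Ccl n n0.
  suff : class_prob R C n <= b by rewrite leNgt big.
  have [/forallP geM|] := boolP [forall T, (d n <= type_count M T)%N]; last first.
    rewrite negb_forall => /existsP[T]; rewrite -ltnNge => ltM.
    by apply: le_trans (class_le_pgf htau n (d n) M _ T n0 CE ltM) (small _).
  (* any fixed type would serve instead of the empty one *)
  apply: (card_le_of_concentrated htau n finset.set0) => // N /CE.
  rewrite gmlu_equivP ?card_ord // => eqMN; rewrite -/s.
  have geN T : n%:R / t - f n <= (type_count N T)%:R :> R.
    by apply: le_trans (dge n n0) _; rewrite ler_nat; move: (eqMN T) (geM T); lia.
  (* the other [t - 1] counts take at least (t - 1) (n / t - f n) of the points *)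
  have leN : (type_count N finset.set0)%:R <= n%:R / t + (t - 1) * f n :> R.
    have := sum_count n N; rewrite (bigD1 finset.set0) //=.
    have := @ler_sum R _ (index_enum _) (predC1 finset.set0) _ _ (fun T _ => geN T).
    rewrite sumr_const cardC1 card_types.
    rewrite -(mulr_natl (n%:R / t - f n)) -subn1 natrB ?expn_gt0 // tE.
    have -> : (t - 1) * (n%:R / t - f n) = n%:R - n%:R / t - (t - 1) * f n.
      by field; rewrite gt_eqF.
    move=> h1 h2; lra.
  have r0 : 0 < sqrtn n by rewrite sqrtr_gt0 ltr0n.
  have r2 : n%:R = sqrtn n ^+ 2 by rewrite sqr_sqrtr.
  have fpos := f0 n n0.
  have tge1 : 1 <= t by rewrite -tE ler1n expn_gt0.
  move: fn; rewrite ltr_pdivrMr // => fn.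
  have tf : t * f n <= s / 2 * sqrtn n.
    have := ler_wpM2l (ltW t0) (ltW fn); congr (_ <= _).
    by field; rewrite gt_eqF.
  (* the threshold for [f n / sqrtn n] was chosen to give this deviation *)
  have y1 : `|(type_count N finset.set0)%:R - n%:R * type_prob R tau| <= s / 2 * sqrtn n.
    apply: le_trans tf; rewrite ler_norml -pE; move: (geN finset.set0) leN; nra.
  rewrite -real_normK ?num_real //.
  apply: (@le_trans _ _ ((s / 2 * sqrtn n) ^+ 2)).
    by rewrite ler_sqr // nnegrE; apply: le_trans y1.
  rewrite exprMn -r2; have -> : (s / 2) ^+ 2 * n%:R = s * (s * n%:R / 4) by field.
  by rewrite ler_piMl // divr_ge0 // mulr_ge0 // ltW.
- move=> f f0 _ dge C Ccl; apply/cvgrPdist_le => e e0; near=> n.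
  have n0 : (0 < n)%N by near: n; exact: nbhs_infty_gt.
  have small c : (bin_pgf (type_prob R tau) n)`_c <= e.
    by move: c; near: n; apply: bin_pgf_coef_small => //; exact: type_prob_bounds.
  have [M CE] := Ccl n n0.
  rewrite sub0r normrN ger0_norm ?divr_ge0 //.
  have [T ltM] : exists T, (type_count M T < d n)%N.
    apply/existsP; rewrite -[X in is_true X]negbK negb_exists.
    apply/negP => /forallP geM.
    have : \sum_(T : {set tau}) (n%:R / t + f n) <= \sum_T (type_count M T)%:R :> R.
      apply: ler_sum => T _; apply: le_trans (dge n n0) _.
      by rewrite ler_nat leqNgt geM.
    rewrite sum_count sumr_const card_types.
    rewrite -(mulr_natl (n%:R / t + f n)) tE mulrDr mulrCA divff ?gt_eqF // mulr1.
    by rewrite gerDl leNgt mulr_gt0 // f0.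
  by apply: le_trans (class_le_pgf htau n (d n) M _ T n0 CE ltM) (small _).
Unshelve. all: by end_near. Qed.
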